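(* For every pGCL program $P$, $\tau\circ[\![P]\!]=K(P)\circ\tau$, where $\tau:\mathsf{FPS}\to\mathcal{M}$, $\tau(F)=\lambda S.\sum_{\sigma\in S}[\sigma]_F$, and $K(P):\mathcal{M}\to\mathcal{M}$ is Kozen's measure-transformer semantics of $P$.
   Context: Fix $k\ge1$ and formal indeterminates $X_1,\dots,X_k$; for $\sigma\in\mathbb{N}^k$, $X^\sigma=X_1^{\sigma_1}\cdots X_k^{\sigma_k}$. $\mathsf{FPS}$ is the set of formal sums $F=\sum_{\sigma\in\mathbb{N}^k}[\sigma]_F X^\sigma$ with $[\sigma]_F\in[0,\infty]$; addition and multiplication by scalars are coefficient-wise. $F\preceq G$ iff $[\sigma]_F\le[\sigma]_G$ for all $\sigma$; transformers are ordered pointwise by $\sqsubseteq$. For $B\subseteq\mathbb{N}^k$, $\langle F\rangle_B=\sum_{\sigma\in B}[\sigma]_F X^\sigma$, $\neg B=\mathbb{N}^k\setminus B$. pGCL programs over variables $x_1,\dots,x_k$ (ranging over $\mathbb{N}$): $P::=\mathtt{skip}\mid x_i:=E\mid P;P\mid \{P\}[p]\{P\}\mid \mathtt{if}(B)\{P\}\mathtt{else}\{P\}\mid \mathtt{while}(B)\{P\}$, with $E$ an arithmetic expression with value $\mathrm{eval}_\sigma(E)\in\mathbb{N}$, $p\in[0,1]$, guards $B\subseteq\mathbb{N}^k$. FPS semantics $[\![P]\!]:\mathsf{FPS}\to\mathsf{FPS}$: $[\![\mathtt{skip}]\!](F)=F$; $[\![x_i:=E]\!](F)=\sum_{\sigma}[\sigma]_F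 X_1^{\sigma_1}\cdots X_i^{\mathrm{eval}_\sigma(E)}\cdots X_k^{\sigma_k}$; $[\![\{P_1\}[p]\{P_2\}]\!](F)=p[\![P_1]\!](F)+(1-p)[\![P_2]\!](F)$; $[\![\mathtt{if}(B)\{P_1\}\mathtt{else}\{P_2\}]\!](F)=[\![P_1]\!](\langle F\rangle_B)+[\![P_2]\!](\langle F\rangle_{\neg B})$; $[\![P_1;P_2]\!](F)=[\![P_2]\!]([\![P_1]\!](F))$; $[\![\mathtt{while}(B)\{P\}]\!]$ is the $\sqsubseteq$-least fixed point of $\Phi_{B,P}(\psi)=\lambda F.\ \langle F\rangle_{\neg B}+\psi([\![P]\!](\langle F\rangle_B))$. $\mathcal{M}$ is the set of measures on $(\mathbb{N}^k,\mathcal{P}(\mathbb{N}^k))$, i.e. countably additive $\mu:\mathcal{P}(\mathbb{N}^k)\to[0,\infty]$ with $\mu(\emptyset)=0$, with pointwise addition, scaling and order; maps $\mathcal{M}\to\mathcal{M}$ are ordered pointwise. For $B\subseteq\mathbb{N}^k$ let $e_B(\mu)=\lambda S.\,\mu(S\cap B)$. Kozen's semantics $K(P):\mathcal{M}\to\mathcal{M}$ (of the translation of $P$ into Kozen's language) is: $K(\mathtt{skip})=\mathrm{id}$; $K(x_i:=E)(\mu)=\lambda S.\,\mu(f_E^{-1}(S))$ where $f_E(\sigma)$ is $\sigma$ with its $i$-th component replaced by $\mathrm{eval}_\sigma(E)$; $K(\{P_1\}[p]\{P_2\})=p\cdot K(P_1)+(1-p)\cdot K(P_2)$; $K(P_1;P_2)=K(P_2)\circ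 K(P_1)$; $K(\mathtt{if}(B)\{P_1\}\mathtt{else}\{P_2\})=K(P_1)\circ e_B+K(P_2)\circ e_{\neg B}$; $K(\mathtt{while}(B)\{P\})$ is the least fixed point of $T_{B,P}(S)=e_{\neg B}+S\circ K(P)\circ e_B$ on maps $\mathcal{M}\to\mathcal{M}$. *)

(* Defs.v *)
From HB Require Import structures.
From mathcomp Require Import all_boot all_order all_algebra.
From mathcomp Require Import all_classical all_reals all_analysis.

Set Implicit Arguments.
Unset Strict Implicit.
Unset Printing Implicit Defensive.

Import Order.TTheory GRing.Theory Num.Theory.
Import numFieldNormedType.Exports.

Local Open Scope classical_set_scope.
Local Open Scope ring_scope.
Local Open Scope ereal_scope.

(* Program states, i.e. exponents of monomials: N^k with the discrete
   sigma-algebra. *)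
Definition state (k : nat) := {ffun 'I_k -> nat}.

HB.instance Definition _ (k : nat) := Choice.on (state k).
HB.instance Definition _ (k : nat) :=
  isPointed.Build (state k) [ffun=> 0%N].
HB.instance Definition _ (k : nat) :=
  @isMeasurable.Build default_measure_display (state k)
    discrete_measurable discrete_measurable0
    discrete_measurableC discrete_measurableU.

Lemma measurable_state (k : nat) (B : set (state k)) : measurable B.
Proof. by []. Qed.

Lemma measurable_fun_state (k : nat) (f : state k -> state k) :
  measurable_fun [set: state k] f.
Proof. by []. Qed.

Definition update (k : nat) (i : 'I_k) (n : nat) (s : state k) : state k :=
  [ffun j => if j == i then n else s j].

(* Arithmetic expressions are embedded through their evaluation function
   sigma |-> eval_sigma(E), and guards as sets of states.  In
   [ProbChoice p P1 P2], P1 is executed with probability p. *)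
Inductive pgcl (R : realType) (k : nat) : Type :=
| Skip
| Assign of 'I_k & (state k -> nat)
| Seq of pgcl R k & pgcl R k
| ProbChoice of {i01 R} & pgcl R k & pgcl R k
| If of set (state k) & pgcl R k & pgcl R k
| While of set (state k) & pgcl R k.

Section LeastFixedPoint.
Variables (T : Type) (le : T -> T -> Prop) (Phi : T -> T).

Definition is_lfp (x : T) := Phi x = x /\ forall y, Phi y = y -> le x y.

(* The least fixed point of Phi; x0 is a junk value, returned only when Phi has
   no least fixed point. *)
Definition lfp (x0 : T) : T := xget (x0 : {classic T}) [set x | is_lfp x].

End LeastFixedPoint.

Definition transformer_le (T : Type) (le : T -> T -> Prop) (f g : T -> T) :=
  forall x, le (f x) (g x).

Section FPS.
Variables (R : realType) (k : nat).

Record fps := Fps {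
  coef :> state k -> \bar R;
  coef_ge0 : forall s, 0 <= coef s }.

Definition fps_le (F G : fps) := forall s, F s <= G s.

Definition fps_add (F G : fps) : fps :=
  @Fps (fun s => F s + G s)
    (fun s => adde_ge0 (coef_ge0 F s) (coef_ge0 G s)).

Lemma fps_scale_subproof (c : {nonneg R}) (F : fps) s : 0 <= c%:num%:E * F s.
Proof. by apply: mule_ge0 => //; exact: coef_ge0. Qed.

Definition fps_scale (c : {nonneg R}) (F : fps) : fps :=
  Fps (fps_scale_subproof c F).

Lemma fps_restrict_subproof (B : set (state k)) (F : fps) s :
  0 <= if s \in B then F s else 0.
Proof. by case: ifP => // _; exact: coef_ge0. Qed.

Definition fps_restrict (B : set (state k)) (F : fps) : fps :=
  Fps (fps_restrict_subproof B F).

Lemma fps_subst_subproof (f : state k -> state k) (F : fps) t :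
  0 <= \esum_(s in [set: state k]) (F s * (t == f s)%:R%:E).
Proof. by apply: esum_ge0 => s _; apply: mule_ge0 => //; exact: coef_ge0. Qed.

(* The formal sum \sum_s [s]_F X^(f s): the coefficient of X^t in the monomial
   X^(f s) is 1 if t = f s and 0 otherwise. *)
Definition fps_subst (f : state k -> state k) (F : fps) : fps :=
  Fps (fps_subst_subproof f F).

Definition fps_while_step (B : set (state k)) (semP : fps -> fps)
    (psi : fps -> fps) : fps -> fps :=
  fun F => fps_add (fps_restrict (~` B) F) (psi (semP (fps_restrict B F))).

Fixpoint fps_sem (P : pgcl R k) : fps -> fps :=
  match P with
  | Skip => fun F => F
  | Assign i E => fun F => fps_subst (fun s => update i (E s) s) F
  | Seq P1 P2 => fun F => fps_sem P2 (fps_sem P1 F)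
  | ProbChoice p P1 P2 => fun F =>
      fps_add (fps_scale (p%:num%:nng)%R (fps_sem P1 F))
              (fps_scale ((1 - p%:num)%:nng)%R (fps_sem P2 F))
  | If B P1 P2 => fun F =>
      fps_add (fps_sem P1 (fps_restrict B F))
              (fps_sem P2 (fps_restrict (~` B) F))
  | While B P1 =>
      lfp (transformer_le fps_le) (fps_while_step B (fps_sem P1)) id
  end.

End FPS.

Section Kozen.
Variables (R : realType) (k : nat).

Local Notation meas := {measure set (state k) -> \bar R}.

Definition meas_le (mu nu : meas) := forall S, mu S <= nu S.

Definition meas_add (mu nu : meas) : meas := measure_add mu nu.

Definition meas_scale (c : {nonneg R}) (mu : meas) : meas := mscale c mu.

Definition meas_restrict (B : set (state k)) (mu : meas) : meas :=
  mrestr mu (measurable_state B).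

(* The measure structure of pushforward takes a measurability proof that is not
   part of the term pushforward mu f, hence the explicit instance. *)
Definition meas_image (f : state k -> state k) (mu : meas) : meas :=
  measure_function_pushforward__canonical__measure_function_Measure
    mu (measurable_fun_state f).

Definition kozen_while_step (B : set (state k)) (KP : meas -> meas)
    (S : meas -> meas) : meas -> meas :=
  fun mu => meas_add (meas_restrict (~` B) mu) (S (KP (meas_restrict B mu))).

Fixpoint kozen (P : pgcl R k) : meas -> meas :=
  match P with
  | Skip => id
  | Assign i E => meas_image (fun s => update i (E s) s)
  | Seq P1 P2 => kozen P2 \o kozen P1
  | ProbChoice p P1 P2 => fun mu =>
      meas_add (meas_scale (p%:num%:nng)%R (kozen P1 mu))
               (meas_scale ((1 - p%:num)%:nng)%R (kozen P2 mu))
  | If B P1 P2 => fun mu =>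
      meas_add (kozen P1 (meas_restrict B mu))
               (kozen P2 (meas_restrict (~` B) mu))
  | While B P1 =>
      lfp (transformer_le meas_le) (kozen_while_step B (kozen P1)) id
  end.

End Kozen.

Section Tau.
Variables (R : realType) (k : nat) (F : fps R k).

Definition tau_fun (S : set (state k)) : \bar R := \esum_(s in S) F s.

Let tau0 : tau_fun set0 = 0.
Proof. exact: esum_set0. Qed.

Let tau_ge0 S : 0 <= tau_fun S.
Proof. by apply: esum_ge0 => s _; exact: coef_ge0. Qed.

Let tau_sigma_additive : semi_sigma_additive tau_fun.
Proof.
move=> A _ tA _; rewrite /tau_fun nneseries_sum_bigcup//; last exact: coef_ge0.
by apply: is_cvg_nneseries => n _ _; exact: tau_ge0.
Qed.

HB.instance Definition _ := isMeasure.Build default_measure_display (state k) R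
  tau_fun tau0 tau_ge0 tau_sigma_additive.

Definition tau : {measure set (state k) -> \bar R} := tau_fun.

End Tau.

(* Main.v *)
Require Import Defs.
From mathcomp Require Import all_boot all_order all_algebra.
From mathcomp Require Import all_classical all_reals all_analysis.

(** As N^k is countable and discrete, a measure is determined by its values on
    singletons, so [tau] is an order isomorphism whose inverse reads off point
    masses.  Checked on point masses, each construct of one semantics is the
    conjugate of the corresponding construct of the other; in particular the two
    loop functionals are conjugate by an order isomorphism, hence so are their
    least fixed points. *)

Set Implicit Arguments.
Unset Strict Implicit.
Unset Printing Implicit Defensive.

Import Order.TTheory GRing.Theory Num.Theory.

Local Open Scope classical_set_scope.
Local Open Scope ring_scope.
Local Open Scope ereal_scope.

Section LfpTransport.
Variables (T U : Type) (leT : T -> T -> Prop) (leU : U -> U -> Prop).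
Variables (h : T -> U) (g : U -> T).
Hypotheses (hK : cancel h g) (gK : cancel g h).
Hypothesis leT_anti : forall x y, leT x y -> leT y x -> x = y.
Hypothesis le_h : forall x y, leU (h x) (h y) <-> leT x y.
Variables (Phi : T -> T) (Psi : U -> U).
Hypothesis h_Phi : forall x, Psi (h x) = h (Phi x).

(** Injectivity of [h] and [h_Phi] match fixed points with fixed points. As every [y : U] is
    [h (g y)], minimality among all fixed points carries over through [le_h]. *)
Lemma is_lfp_transport x : is_lfp leU Psi (h x) <-> is_lfp leT Phi x.
Proof.
have fixE y : Psi (h y) = h y <-> Phi y = y.
  by rewrite h_Phi; split=> [/(can_inj hK)|->].
split=> -[/fixE fx lex]; split=> // y fy.
  by apply/le_h/lex/fixE.
by rewrite -(gK y); apply/le_h/lex/fixE; rewrite gK.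
Qed.

(* If there is no least fixed point, both sides are junk values, which [h] also
   relates. *)
Lemma lfp_transport x0 : lfp leU Psi (h x0) = h (lfp leT Phi x0).
Proof.
(* [xget] picks an unspecified element, so antisymmetry is what pins down the value of [lfp]. *)
have lfp_uniq x y : is_lfp leT Phi x -> is_lfp leT Phi y -> x = y.
  by move=> [fx lex] [fy ley]; apply: leT_anti; [exact: lex|exact: ley].
rewrite /lfp.
have [[x lx]|no_lfp] := pselect (exists x, is_lfp leT Phi x).
  rewrite (@xget_unique {classic T} x0 _ x lx); last first.
    by move=> y ly; exact: lfp_uniq.
  apply: (@xget_unique {classic U}); first exact/is_lfp_transport.
  move=> y; rewrite -[y in _ y]gK => /is_lfp_transport ly.
  by rewrite -(lfp_uniq _ _ ly lx) gK.
rewrite (@xgetPN {classic T}) ?(@xgetPN {classic U}) // => x lx; apply: no_lfp.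
  by exists (g x); apply/is_lfp_transport; rewrite gK.
by exists x.
Qed.

End LfpTransport.

Section PointMass.
Variables (R : realType) (k : nat).
Local Notation meas := {measure set (state k) -> \bar R}.

Lemma fps_ext (F G : fps R k) : F =1 G -> F = G.
Proof.
case: F G => [f f0] [g g0] /= /funext fg.
by case: _ / fg g0 => g0; congr Fps; exact: Prop_irrelevance.
Qed.

Lemma measure_state_ext (mu nu : meas) :
  (forall s, mu [set s] = nu [set s]) -> mu = nu.
Proof.
move=> eq_pt; apply: eq_measure; apply/funext => A.
(* [pickle] is injective, so this cuts [A] into countably many pieces, each empty or a singleton,
   and countable additivity applies. *)
pose F n := A `&` [set s : state k | pickle (s : {ffun 'I_k -> nat}) = n].
have -> : A = \bigcup_n F n.
  by apply/seteqP; split=> [s As|s [n _ []]//]; exists (pickle s).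
have tF : trivIset [set: nat] F by move=> m n _ _ [s [[_ <-] [_ <-]]].
rewrite !measure_semi_bigcup//; apply: eq_eseriesr => n _.
have [->|/set0P[s [As sn]]] := eqVneq (F n) set0; first by rewrite !measure0.
suff -> : F n = [set s] by [].
apply/seteqP; split=> [t [_ tn]|_ ->]; last by split.
by apply/(pcan_inj (@pickleK {ffun 'I_k -> nat})); rewrite tn sn.
Qed.

Definition point_mass (mu : meas) : fps R k :=
  Fps (fun s => measure_ge0 mu [set s]).

Lemma tauK : cancel (@tau R k) point_mass.
Proof.
by move=> F; apply: fps_ext => s; rewrite /= /tau_fun esum_set1 ?coef_ge0.
Qed.

Lemma point_massK : cancel point_mass (@tau R k).
Proof.
move=> mu; apply: measure_state_ext => s.
by rewrite /= /tau_fun esum_set1 ?measure_ge0.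
Qed.

(** An inequality on singletons extends to all sets because each measure is the sum of its point
    masses. *)
Lemma fps_le_point_mass (mu nu : meas) :
  fps_le (point_mass mu) (point_mass nu) <-> meas_le mu nu.
Proof.
split=> [le_pt S|le_mn s]; last exact: le_mn.
rewrite -(point_massK mu) -(point_massK nu).
by apply: le_esum => s _; exact: le_pt.
Qed.

Lemma meas_le_anti (mu nu : meas) : meas_le mu nu -> meas_le nu mu -> mu = nu.
Proof.
move=> le_mn le_nm; apply: measure_state_ext => s.
by apply/eqP; rewrite eq_le le_mn le_nm.
Qed.

Lemma point_mass_add (mu nu : meas) :
  point_mass (meas_add mu nu) = fps_add (point_mass mu) (point_mass nu).
Proof. by apply: fps_ext => s; exact: measure_addE. Qed.

Lemma point_mass_scale c (mu : meas) :
  point_mass (meas_scale c mu) = fps_scale c (point_mass mu).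
Proof. exact: fps_ext. Qed.

Lemma point_mass_restrict B (mu : meas) :
  point_mass (meas_restrict B mu) = fps_restrict B (point_mass mu).
Proof.
apply: fps_ext => s; rewrite /= /mrestr; case: ifPn => [/set_mem Bs|/negP Bs].
  by congr (mu _); apply/seteqP; split=> [t []|_ ->].
rewrite (_ : _ `&` _ = set0) ?measure0//.
by rewrite -subset0 => t [->] Bt; apply: Bs; exact/mem_set.
Qed.

Lemma point_mass_image f (mu : meas) :
  point_mass (meas_image f mu) = fps_subst f (point_mass mu).
Proof.
(* Only the mass of the preimage of [t] is expanded, as a sum over its points; its indicator is the
   factor in [fps_subst]. *)
apply: fps_ext => t; rewrite /= /pushforward -{1}(point_massK mu).
rewrite /= /tau_fun esum_mkcond; apply: eq_esum => s _ /=.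
case: ifPn => [/set_mem/= ->|/negP fs]; first by rewrite eqxx mule1.
by case: eqP => [tE|_]; [case: fs; apply/mem_set|rewrite mule0].
Qed.

Lemma fps_sem_point_mass (P : pgcl R k) (mu : meas) :
  fps_sem P (point_mass mu) = point_mass (kozen P mu).
Proof.
elim: P mu => [|i E|P1 IH1 P2 IH2|p P1 IH1 P2 IH2|B P1 IH1 P2 IH2|B P IH] mu /=.
- by [].
- by rewrite point_mass_image.
- by rewrite IH1 IH2.
- by rewrite point_mass_add !point_mass_scale IH1 IH2.
- by rewrite point_mass_add -!point_mass_restrict IH1 IH2.
(* Conjugation by [tau] and [point_mass] is an order isomorphism between the two kinds of
   transformers, to which [lfp_transport] applies. *)
pose h (S : meas -> meas) := point_mass \o S \o @tau R k.
pose g (psi : fps R k -> fps R k) := @tau R k \o psi \o point_mass.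
have hK : cancel h g.
  by move=> S; apply/funext => nu; rewrite /g /h /= !point_massK.
have gK : cancel g h by move=> S; apply/funext => F; rewrite /g /h /= !tauK.
(* The junk values of the two [lfp] must correspond as well. *)
have h_id : h id = id by apply/funext => F; rewrite /h /= tauK.
have -> : lfp (transformer_le (@fps_le R k)) (fps_while_step B (fps_sem P)) id =
    h (lfp (transformer_le (@meas_le R k)) (kozen_while_step B (kozen P)) id).
  rewrite -{1}h_id; apply: (lfp_transport hK gK).
  - move=> S S' leS leS'; apply/funext => nu.
    by apply: meas_le_anti; [exact: leS|exact: leS'].
  - move=> S S'; split=> leS; last by move=> F; exact/fps_le_point_mass/leS.
    move=> nu; apply/fps_le_point_mass.
    by have := leS (point_mass nu); rewrite /h /= point_massK.
  (* Every series is a point-mass series, here that of [nu], so the restriction lemma and the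
     induction hypothesis apply. *)
  - move=> S; apply/funext => F; rewrite -[F]tauK; set nu := tau F.
    rewrite /h /fps_while_step /kozen_while_step /= point_massK.
    by rewrite point_mass_add -!point_mass_restrict IH point_massK.
by rewrite /h /= point_massK.
Qed.

End PointMass.

Theorem theorem5 (R : realType) (k : nat) (hk : (1 <= k)%N) (P : pgcl R k) :
  @tau R k \o fps_sem P = kozen P \o @tau R k.
Proof.
by apply/funext => F; rewrite /= -{1}[F]tauK fps_sem_point_mass point_massK.
Qed.
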